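(* There exist point sets $A,B\subset\mathbb{R}^d$ with $|A|=|B|=n$ and minimum matching cost $M$ between them such that, if they are randomly projected down to $m=o(\log n)$ dimensions using an appropriately scaled Gaussian random matrix, the pull-back cost of the optimal matching in $\mathbb{R}^m$ is at least $\omega(M)$.
   Context: The matching cost between $A$ and $B$ of a perfect matching is the sum of Euclidean distances of matched pairs; $M$ is the minimum over perfect matchings. For a projection $\pi:\mathbb{R}^d\to\mathbb{R}^m$, the optimal matching in $\mathbb{R}^m$ is a minimum-cost perfect matching between $\pi(A)$ and $\pi(B)$; its pull-back cost is the cost of the same matching (same pairs) evaluated on the original points in $\mathbb{R}^d$. Asymptotic notation is as $n\to\infty$. *)

(* Defs.v *)
From HB Require Import structures.
From mathcomp Require Import all_boot all_order all_algebra all_fingroup.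
From mathcomp Require Import all_classical all_reals all_analysis.

Set Implicit Arguments.
Unset Strict Implicit.
Unset Printing Implicit Defensive.

Import Order.TTheory GRing.Theory Num.Theory.
Import numFieldNormedType.Exports.

Local Open Scope classical_set_scope.
Local Open Scope ring_scope.

(* The norm [`|x|] of 'rV[R]_d in the library is the sup norm, hence this
   separate Euclidean norm. *)
Definition enorm (R : realType) (d : nat) (x : 'rV[R]_d) : R :=
  Num.sqrt (\sum_(i < d) x ord0 i ^+ 2).

(* Point sets of cardinality n are enumerated by 'I_n (injectively, in the
   statement); the perfect matching s pairs A i with B (s i). *)
Definition matching_cost (R : realType) (d n : nat)
    (A B : 'I_n -> 'rV[R]_d) (s : 'S_n) : R :=
  \sum_(i < n) enorm (A i - B (s i)).

(* The default value of the iterated minimum is itself one of the terms, so it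
   does not affect the result. *)
Definition min_matching_cost (R : realType) (d n : nat)
    (A B : 'I_n -> 'rV[R]_d) : R :=
  \big[Order.min/matching_cost A B 1%g]_(s : 'S_n) matching_cost A B s.

Definition optimal_matching (R : realType) (d n : nat)
    (A B : 'I_n -> 'rV[R]_d) (s : 'S_n) : Prop :=
  matching_cost A B s = min_matching_cost A B.

Definition project (R : realType) (d m n : nat) (W : 'M[R]_(d, m))
    (A : 'I_n -> 'rV[R]_d) : 'I_n -> 'rV[R]_m :=
  fun i => A i *m W.

(* An optimal matching of the projected points need not be unique, so the bound
   is required of every one of them. *)
Definition pullback_cost_gt (R : realType) (d m n : nat)
    (A B : 'I_n -> 'rV[R]_d) (W : 'M[R]_(d, m)) (c : R) : Prop :=
  forall s : 'S_n, optimal_matching (project W A) (project W B) s ->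
    c < matching_cost A B s.

Definition mutually_independent (R : realType) (disp : measure_display)
    (T : measurableType disp) (P : probability T R) (I : finType)
    (X : I -> {RV P >-> R}) : Prop :=
  forall (J : {set I}) (E : I -> set R), (forall i, measurable (E i)) ->
    (P (\bigcap_(i in [set` J]) (X i @^-1` E i))
       = \prod_(i in J) P (X i @^-1` E i))%E.

(* The second parameter of [normal_prob] is the standard deviation: the entries
   are i.i.d. N(0, 1/m), so that the projection preserves squared Euclidean
   norms in expectation. *)
Definition gaussian_projection (R : realType) (disp : measure_display)
    (T : measurableType disp) (P : probability T R) (d m : nat)
    (G : 'I_d * 'I_m -> {RV P >-> R}) : Prop :=
  mutually_independent G /\
  forall (ij : 'I_d * 'I_m) (U : set R), measurable U ->
    distribution P (G ij) U = normal_prob 0 (Num.sqrt m%:R)^-1 U.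

Definition random_mx (R : realType) (disp : measure_display)
    (T : measurableType disp) (P : probability T R) (d m : nat)
    (G : 'I_d * 'I_m -> {RV P >-> R}) (w : T) : 'M[R]_(d, m) :=
  \matrix_(i < d, j < m) G (i, j) w.

(* Main.v *)
Require Import Defs.
From HB Require Import structures.
From mathcomp Require Import all_boot all_order all_algebra all_fingroup.
From mathcomp Require Import all_classical all_reals all_analysis.
From mathcomp Require Import measurable_realfun.
From mathcomp Require Import zify ring lra.

Set Implicit Arguments.
Unset Strict Implicit.
Unset Printing Implicit Defensive.

Import Order.TTheory GRing.Theory Num.Theory.
Import numFieldNormedType.Exports.

Local Open Scope classical_set_scope.
Local Open Scope ring_scope.

(** Fix a unit direction [u] and mutually far anchors [z_i], with [z_i] at
    distance [L_i] from the origin.  Pair [i] is [(z_i, z_i + u)] for even [i]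
    and [(z_i + u, z_i)] for odd [i]: the identity matching costs [n], while
    matching [i] with some [k <> i] costs at least [L_i].  After projection, an
    even and an odd index whose anchors land in a common cell of diameter
    [delta] can swap partners, paying [delta] instead of the length of the image
    of [u].  Only [exp(O(m)) = n^o(1)] cells of [R^m] matter, and in each of them
    the numbers of even and odd anchors differ by [O(sqrt n)], because the
    anchors [2j] and [2j + 1] have independent images with the same law.  Hence
    almost all indices can swap, and an optimal projected matching fixes at most
    a small fraction of the indices.  Finally [L_i = (n / (i./2 + 1))^2], so that
    for each [h] the first [n / h] indices have [L_i >= h^2] and already force a
    pull-back cost of order [h n]. *)

(** * Swapping indices of opposite colours inside cells *)

(** Take a permutation that moves as many points as possible, each moved point staying in its cell
    and changing colour. In a cell the moved points cancel in the signed sum and the fixed ones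
    share one colour, so the number of fixed points there is the absolute value of that sum. *)
Lemma exists_cell_perm (R : realDomainType) (I Q : finType)
    (c : I -> option Q) (b : I -> bool) :
  exists s : {perm I},
    (forall i, s i != i ->
       [/\ c i != None, c (s i) = c i & b (s i) = ~~ b i]) /\
    (#|[set i | s i == i]%SET|%:R : R) <=
      #|[set i | c i == None]%SET|%:R +
      \sum_(q : Q) `| \sum_(i | c i == Some q) (-1) ^+ b i |.
Proof.
pose ok (s : {perm I}) := [forall i, (s i != i) ==>
  [&& c i != None, c (s i) == c i & b (s i) == ~~ b i]].
have ok1 : ok 1%g by apply/forallP => i; rewrite perm1 eqxx.
pose moved (s : {perm I}) := #|[set i | s i != i]%SET|.
case: (@arg_maxnP _ 1%g ok moved ok1) => s oks smax.
have sP i : s i != i -> [/\ c i != None, c (s i) = c i & b (s i) = ~~ b i].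
  by move=> h; have /forallP/(_ i) := oks; rewrite h /= => /and3P[-> /eqP-> /eqP->].
exists s; split => //.
(* By maximality, the fixed points of one cell all have the same colour. *)
have fixP q i j : s i = i -> s j = j -> c i = Some q -> c j = Some q -> b i = b j.
  move=> si sj ci cj; apply/eqP/negPn/negP => bij.
  have ij : i != j by apply: contraNneq bij => ->.
  (* Two fixed points of opposite colours could be exchanged: [t] moves both of them and every point
     that [s] moves. *)
  pose t := (tperm i j * s)%g.
  have tE k : t k = if k == i then j else if k == j then i else s k.
    rewrite permM; case: tpermP => [->|->|/eqP ki /eqP kj].
    - by rewrite eqxx sj.
    - by rewrite eq_sym (negbTE ij) eqxx si.
    - by rewrite (negbTE ki) (negbTE kj).
  have okt : ok t.
    apply/forallP => k; apply/implyP; rewrite tE.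
    case: (eqVneq k i) => [->|ki]; last case: (eqVneq k j) => [->|kj].
    - by move=> _; rewrite ci cj eqxx /=; case: (b i) (b j) bij => [] [].
    - by move=> _; rewrite ci cj eqxx /=; case: (b i) (b j) bij => [] [].
    - by move=> /sP[-> -> ->]; rewrite !eqxx.
  have := smax t okt; apply/negP; rewrite -ltnNge; apply: proper_card.
  apply/properP; split.
    apply/fintype.subsetP => k; rewrite !inE tE => sk.
    case: (eqVneq k i) => [ki|_]; first by rewrite ki si eqxx in sk.
    by case: (eqVneq k j) => [kj|//]; rewrite kj sj eqxx in sk.
  by exists i; rewrite !inE ?si ?eqxx// tE eqxx eq_sym.
have Dq q : `| \sum_(i | c i == Some q) (-1) ^+ b i | =
    #|[set i | (s i == i) && (c i == Some q)]%SET|%:R :> R.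
  rewrite (bigID (fun i => s i == i)) /=.
  rewrite [X in _ + X](_ : _ = 0) ?addr0; last first.
    set S := \sum_(i | _) _.
    (* Reindexing along [s] keeps the cell and flips the colour of each moved point. *)
    have : S = - S.
      rewrite {1}/S (reindex_inj (@perm_inj _ s)) /= /S -sumrN.
      apply: eq_big => i; first rewrite (inj_eq (@perm_inj _ s)).
        by case: (eqVneq (s i) i) => [->|/sP[_ -> _]]; rewrite ?andbF.
      rewrite (inj_eq (@perm_inj _ s)) => /andP[_ /sP[_ _ ->]].
      by case: (b i); rewrite ?expr0 ?expr1 ?opprK.
    by move/eqP; rewrite -subr_eq0 opprK -mulr2n mulrn_eq0 /= => /eqP.
  case: (pickP (fun i => (s i == i) && (c i == Some q))) => [i0|no]; last first.
    rewrite big_pred0; last by move=> i; rewrite andbC no.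
    rewrite normr0 (_ : [set i | _]%SET = finset.set0) ?cards0//.
    by apply/finset.setP => i; rewrite !inE no.
  move=> /andP[/eqP si0 /eqP ci0].
  rewrite (eq_bigr (fun=> (-1) ^+ b i0)); last first.
    by move=> i /andP[/eqP ci /eqP si]; congr (_ ^+ _); rewrite (fixP q i i0).
  rewrite sumr_const normrMn normrX normrN1 expr1n.
  by congr (_%:R); apply: eq_card => i; rewrite !inE andbC.
rewrite (eq_bigr _ (fun q _ => Dq q)) -natr_sum -natrD ler_nat.
rewrite -sum1_card (bigID (fun i => c i == None)) /= leq_add//.
  rewrite sum1_card; apply/subset_leq_card/fintype.subsetP => i.
  by rewrite !inE => /andP[].
rewrite (partition_big (fun i => c i) (fun q => q != None)) /=; last first.
  by move=> i /andP[].
rewrite [X in (X <= _)%N](reindex_omap Some id)/=; last by case.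
rewrite leq_eqVlt; apply/orP; left; apply/eqP/eq_big => [q|q _]; first by rewrite eqxx.
rewrite -sum1_card; apply: eq_bigl => i; rewrite !inE.
by case: (s i == i) => //=; case: eqVneq => [->|]; rewrite /= ?andbF.
Qed.

(** * Estimates for one Gaussian variable *)

(** [normal_pdf] agrees almost everywhere with the Radon-Nikodym derivative, since both have the
    same integral over every measurable set. *)
Lemma ge0_integral_normal_prob (R : realType) (s : R) (f : R -> \bar R) :
  measurable_fun setT f -> (forall x, 0 <= f x)%E ->
  (\int[normal_prob 0 s]_x f x =
   \int[lebesgue_measure]_x (f x * (normal_pdf 0 s x)%:E))%E.
Proof.
move=> mf f0.
have dom := @normal_prob_dominates R 0 s.
rewrite -(Radon_Nikodym_SigmaFinite.change_of_variables dom f0 measurableT mf).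
have mpdf : measurable_fun setT (fun x : R => (normal_pdf 0 s x)%:E).
  by apply/measurable_EFinP; exact: measurable_normal_pdf.
have RNint := Radon_Nikodym_SigmaFinite.f_integrable dom.
apply: ae_eq_integral => //.
- by apply: emeasurable_funM => //; exact: measurable_int RNint.
- exact: emeasurable_funM.
- apply: ae_eqe_mul2l; apply: integral_ae_eq => //.
  by move=> E _ mE; rewrite -Radon_Nikodym_SigmaFinite.f_integral.
Qed.

Lemma normal_peak_le (R : realType) (s : R) : 0 < s -> normal_peak s <= s^-1.
Proof.
move=> s0; rewrite /normal_peak lef_pV2 ?posrE//; last first.
  by rewrite sqrtr_gt0 pmulrn_lgt0// mulr_gt0 ?exprn_gt0 ?pi_gt0.
rewrite -[leLHS](ger0_norm (ltW s0)) -sqrtr_sqr ler_wsqrtr//.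
rewrite -mulrnAr ler_peMr ?sqr_ge0//.
by have := pi_ge2 R; lra.
Qed.

(* The factor [|x|] is absorbed by doubling the standard deviation, as
   [y <= exp(3 y^2 / 8)]. *)
Lemma normal_pdf_abs_le (R : realType) (s x : R) : 0 < s ->
  `|x| * normal_pdf 0 s x <= 2 * s * normal_pdf 0 (2 * s) x.
Proof.
move=> s0.
have s20 : 0 < 2 * s by lra.
rewrite !normal_pdfE ?gt_eqF//.
have -> : normal_peak s = 2 * normal_peak (2 * s).
  rewrite /normal_peak.
  have -> : (2 * s) ^+ 2 * pi *+ 2 = 2 ^+ 2 * (s ^+ 2 * pi *+ 2) :> R by ring.
  by rewrite sqrtrM ?sqr_ge0// sqrtr_sqr ger0_norm// invfM mulrA divff// mul1r.
pose y := `|x| / s.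
have xE : `|x| = s * y by rewrite mulrCA divff ?mulr1// gt_eqF.
have -> : normal_fun 0 s x = normal_fun 0 (2 * s) x * expR (- (3 / 8 * y ^+ 2)).
  rewrite /normal_fun -expRD subr0 /y expr_div_n real_normK ?num_real//.
  by congr expR; field; rewrite gt_eqF.
have fge0 := normal_fun_ge0 0 (2 * s) x.
have pge0 := normal_peak_ge0 (2 * s).
set f := normal_fun 0 (2 * s) x in fge0 *.
set p := normal_peak (2 * s) in pge0 *.
have h : y * expR (- (3 / 8 * y ^+ 2)) <= 1.
  rewrite expRN ler_pdivrMr ?expR_gt0// mul1r.
  (* Here [1 + 3/8 y^2 - y] equals [3/8 (y - 4/3)^2 + 1/3]. *)
  by apply: le_trans (expR_ge1Dx _); have := sqr_ge0 (y - 4 / 3); nra.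
rewrite xE (_ : s * y * _ = 2 * s * (p * f) * (y * expR (- (3 / 8 * y ^+ 2)))).
  by rewrite ler_piMr// !mulr_ge0// ltW.
by ring.
Qed.

Section normal_variable.
Context (R : realType) (disp : measure_display) (T : measurableType disp).
Context (P : probability T R) (X : {RV P >-> R}) (s : R).
Hypothesis s0 : 0 < s.
Hypothesis XN : forall U : set R, measurable U ->
  distribution P X U = normal_prob 0 s U.

(** The density is at most [1 / s] and the interval has length [2 r]. *)
Lemma normal_small_ball (r : R) : 0 <= r ->
  (P [set w | (`|X w| < r)%R] <= (2 * r / s)%:E)%E.
Proof.
move=> r0.
have -> : [set w | `|X w| < r] = X @^-1` `](- r), r[.
  by apply/seteqP; split => w /=; rewrite in_itv/= ltr_norml.
have mI : measurable (`](- r), r[ : set R) by exact: measurable_itv.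
have := XN mI; rewrite /distribution /pushforward/= => ->.
rewrite /normal_prob.
apply: (@le_trans _ _ (\int[lebesgue_measure]_(x in `](- r)%R, r[) (s^-1)%:E)%E).
  apply: ge0_le_integral => //=.
  - by move=> x _; rewrite lee_fin normal_pdf_ge0.
  - by apply/measurable_EFinP/measurable_funTS; exact: measurable_normal_pdf.
  - move=> x _; rewrite lee_fin (le_trans (normal_pdf_ub _ _ _)) ?gt_eqF//.
    exact: normal_peak_le.
rewrite integral_cst//= lebesgue_measure_itv/=; case: ifPn => _.
  by rewrite -EFinD -EFinM lee_fin opprK mulrC; lra.
by rewrite mule0 lee_fin divr_ge0 ?mulr_ge0// ltW.
Qed.

(** [normal_pdf_abs_le] bounds the integrand by [2 s] times a density, whose total mass is 1. *)
Lemma normal_abs_moment : (\int[P]_w (`|X w|)%:E <= (2 * s)%:E)%E.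
Proof.
have mabs : measurable_fun setT (fun x : R => (`|x|)%:E).
  by apply/measurable_EFinP; exact: normr_measurable.
pose Y : T -> measurableTypeR R := X.
have mY : measurable_fun setT Y by exact: (measurable_funPT X).
have -> : (\int[P]_w (`|X w|)%:E = \int[pushforward P Y]_x (`|x : R|)%:E)%E.
  by rewrite ge0_integral_pushforward// => x; rewrite lee_fin.
have -> : (\int[pushforward P Y]_x (`|x : R|)%:E =
    \int[normal_prob 0 s]_x (`|x|)%:E)%E.
  by apply: eq_measure_integral => A mA _; exact: XN.
rewrite ge0_integral_normal_prob//.
apply: (@le_trans _ _
  (\int[lebesgue_measure]_x ((2 * s)%:E * (normal_pdf 0 (2 * s) x)%:E))%E).
  apply: ge0_le_integral => //=.
  - by move=> x _; rewrite lee_fin mulr_ge0 ?normal_pdf_ge0.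
  - apply/measurable_EFinP/measurable_funM; first exact: normr_measurable.
    exact: measurable_normal_pdf.
  - apply/measurable_EFinP/measurable_funM => //.
    exact: measurable_normal_pdf.
  - by move=> x _; rewrite -EFinM lee_fin normal_pdf_abs_le.
rewrite ge0_integralZl//=; first by rewrite integral_normal_pdf mule1.
- by apply/measurable_EFinP; exact: measurable_normal_pdf.
- by move=> x _; rewrite lee_fin normal_pdf_ge0.
- by rewrite lee_fin mulr_ge0// ltW.
Qed.

End normal_variable.

(** * Markov's inequality and the second moment of an alternating count *)

Section finite_expectations.
Context (R : realType) (disp : measure_display) (T : measurableType disp).
Variable P : probability T R.

Lemma ge0_markov (f : T -> R) (c t : R) : measurable_fun setT f ->
  (forall w, 0 <= f w) -> 0 < t -> (\int[P]_w (f w)%:E <= c%:E)%E ->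
  (P [set w | (t <= f w)%R] <= (c / t)%:E)%E.
Proof.
move=> mf f0 t0 Ef; set A := [set w | _].
have mA : measurable A.
  have := measurable_fun_ler (measurable_cst t) mf.
  by move=> /(_ measurableT [set true]); rewrite setTI; exact.
rewrite EFinM lee_pdivlMr// (le_trans _ Ef)//.
apply: (@le_trans _ _ (\int[P]_(w in A) (f w)%:E)%E).
  rewrite muleC -integral_cst//; apply: ge0_le_integral => //=.
  - by move=> w _; rewrite lee_fin ltW.
  - by apply/measurable_EFinP; exact: measurable_funTS.
apply: ge0_subset_integral => //; first exact/measurable_EFinP.
by move=> w _; rewrite lee_fin.
Qed.

Lemma integral_sum_indic (K : finType) (c : K -> R) (E : K -> set T) :
  (forall k, measurable (E k)) ->
  (\int[P]_w (\sum_k c k * \1_(E k) w)%:E =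
   (\sum_k c k * fine (P (E k)))%:E)%E.
Proof.
move=> mE; under eq_integral do rewrite -sumEFin.
have int1 k : P.-integrable setT (fun w => (\1_(E k) w)%:E).
  by exact: integrable_indic.
rewrite integral_sum//=; last first.
  by move=> k; exact: (integrableZl measurableT (c k) (int1 k)).
rewrite -sumEFin; apply: eq_bigr => k _; under eq_integral do rewrite EFinM.
rewrite integralZl//= integral_indic// setIT EFinM fineK//.
exact: fin_num_measure.
Qed.

(** The terms [2j] and [2j + 1] cancel, which leaves at most the last one. *)
Lemma alternating_sum (p : nat -> R) (n : nat) :
  (forall j, p j.*2 = p j.*2.+1) ->
  \sum_(i < n) (-1) ^+ odd i * p i = if odd n then p n.-1 else 0.
Proof.
move=> pE; elim: n => [|n IH]; first by rewrite big_ord0.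
rewrite big_ord_recr /= IH; case: n {IH} => [|n] /=.
  by rewrite expr0 mul1r add0r.
rewrite negbK; case: (boolP (odd n)) => on /=; rewrite ?add0r ?expr0 ?mul1r//.
have -> : p n.+1 = p n.
  rewrite -[in p n](odd_double_half n) -[in p n.+1](odd_double_half n).
  by rewrite (negbTE on) add0n pE.
by rewrite expr1 mulN1r subrr.
Qed.

(** Off the diagonal, pairwise independence factors the terms. Completing the diagonal turns the
    double sum into the square of an alternating sum, at most 1, and each of the [n] diagonal
    corrections [p i - p i ^ 2] is at most 1. *)
Lemma alternating_indic_sq (n : nat) (E : 'I_n -> set T) (p : nat -> R) :
  (forall i, measurable (E i)) ->
  (forall j, p j.*2 = p j.*2.+1) ->
  (forall i, P (E i) = (p i)%:E) ->
  (forall i j, i != j -> P (E i `&` E j) = (p i * p j)%:E) ->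
  (\int[P]_w ((\sum_(i < n) (-1) ^+ odd i * \1_(E i) w) ^+ 2)%:E <= (n.+1%:R)%:E)%E.
Proof.
move=> mE pE PE PEE.
have p01 (i : 'I_n) : 0 <= p i <= 1.
  by rewrite -!lee_fin -PE measure_ge0 probability_le1.
pose s (i : 'I_n) : R := (-1) ^+ odd i.
have s2 i : s i * s i = 1 by rewrite /s -expr2 sqrr_sign.
under eq_integral => w _.
  have -> : (\sum_(i < n) (-1) ^+ odd i * \1_(E i) w) ^+ 2 =
      \sum_(k : 'I_n * 'I_n) (s k.1 * s k.2) * \1_(E k.1 `&` E k.2) w.
    rewrite expr2 big_distrlr /= pair_big /=; apply: eq_bigr => k _.
    by rewrite indicI /= mulrACA.
  over.
rewrite integral_sum_indic; last by move=> k; exact: measurableI.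
rewrite lee_fin.
rewrite (eq_bigr (fun k : 'I_n * 'I_n => (s k.1 * p k.1) * (s k.2 * p k.2) +
   (if k.1 == k.2 then p k.1 - p k.1 ^+ 2 else 0))); last first.
  move=> [i j] _ /=; case: eqVneq => [<-|ij].
    by rewrite setIid PE /= [X in _ = X + _]mulrACA s2; ring.
  by rewrite PEE//= addr0 mulrACA.
rewrite big_split /= -natr1 addrC lerD//.
  rewrite -(pair_big predT predT
    (fun i j : 'I_n => if i == j then p i - p i ^+ 2 else 0)) /=.
  rewrite [leRHS](_ : _ = \sum_(i < n) 1); last by rewrite sumr_const card_ord.
  apply: ler_sum => i _; rewrite -big_mkcond /=.
  rewrite (big_pred1 i) => [|j]; last by rewrite eq_sym.
  by have := p01 i; nra.
rewrite -(pair_big predT predT (fun i j : 'I_n => s i * p i * (s j * p j))) /=.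
rewrite -big_distrlr /= alternating_sum//; case: ifP => odd_n; last by rewrite mulr0.
have n0 : (n.-1 < n)%N by case: (n) odd_n.
by have /andP[/= ? ?] := p01 (Ordinal n0); nra.
Qed.

End finite_expectations.

(** * Independence of the rows of the random matrix *)

Section independent_rows.
Context (R : realType) (disp : measure_display) (T : measurableType disp).
Variables (P : probability T R) (d m : nat).
Variables (G : 'I_d * 'I_m -> {RV P >-> R}) (S : 'I_d -> 'I_m -> set R).
Hypothesis indG : mutually_independent G.
Hypothesis mS : forall i j, measurable (S i j).

Let row_event (i : 'I_d) : set T := [set w | forall j, S i j (G (i, j) w)].

(** Independence is applied to all entries in the rows of [K]; the cases of one and of two rows
    together make the row events pairwise independent. *)
Lemma row_eventE (K : {set 'I_d}) :
  P [set w | forall i, i \in K -> row_event i w] =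
  (\prod_(i in K) \prod_(j < m) P (G (i, j) @^-1` S i j))%E.
Proof.
have := indG [set ij : 'I_d * 'I_m | ij.1 \in K]%SET
  (E := fun ij => S ij.1 ij.2) (fun ij => mS ij.1 ij.2).
have -> : \bigcap_(ij in [set` [set ij : 'I_d * 'I_m | ij.1 \in K]%SET])
    G ij @^-1` S ij.1 ij.2 = [set w | forall i, i \in K -> row_event i w].
  apply/seteqP; split => w /=.
    by move=> h i iK j; apply: (h (i, j)); rewrite /= inE.
  by move=> h [i j]; rewrite /= inE /= => iK; exact: h.
move=> ->; rewrite pair_big /=; apply: eq_big => [[i j]|[i j] _] //=.
by rewrite inE andbT.
Qed.

Lemma row_event1 (i : 'I_d) :
  P (row_event i) = (\prod_(j < m) P (G (i, j) @^-1` S i j))%E.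
Proof.
have := row_eventE [set i]%SET; rewrite big_set1 => <-; congr (P _).
by apply/seteqP; split => w /=; [move=> h k; rewrite inE => /eqP -> | apply; rewrite inE].
Qed.

Lemma row_eventI (i k : 'I_d) : i != k ->
  P (row_event i `&` row_event k) = (P (row_event i) * P (row_event k))%E.
Proof.
move=> ik; rewrite !row_event1.
have := row_eventE [set i; k]%SET.
rewrite big_setU1 ?inE//= big_set1 => <-; congr (P _).
apply/seteqP; split => w /=.
  by move=> [hi hk] l; rewrite !inE => /orP[] /eqP ->.
by move=> h; split; apply: h; rewrite !inE eqxx ?orbT.
Qed.

End independent_rows.

(** * The Euclidean norm and elementary bounds on matching costs *)

Section enorm_theory.
Context (R : realType) (m : nat).
Implicit Types x : 'rV[R]_m.

Lemma enorm_ge0 x : 0 <= enorm x. Proof. exact: sqrtr_ge0. Qed.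

Lemma enorm_sign (b : bool) x : enorm ((-1) ^+ b *: x) = enorm x.
Proof.
rewrite /enorm; congr Num.sqrt; apply: eq_bigr => j _.
by rewrite mxE exprMn sqrr_sign mul1r.
Qed.

Lemma coord_le_enorm x k : `|x ord0 k| <= enorm x.
Proof.
rewrite -sqrtr_sqr ler_wsqrtr// (bigD1 k)//= lerDl sumr_ge0// => j _.
exact: sqr_ge0.
Qed.

Lemma enorm_le_coord x (b : R) : 0 <= b ->
  (forall k, `|x ord0 k| <= b) -> enorm x <= Num.sqrt m%:R * b.
Proof.
move=> b0 xb; rewrite -[b in leRHS](ger0_norm b0) -sqrtr_sqr -sqrtrM// ler_wsqrtr//.
rewrite mulr_natl -[X in _ *+ X](card_ord m) -sumr_const ler_sum// => k _.
by rewrite -real_normK ?num_real// lerXn2r ?nnegrE ?xb.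
Qed.

End enorm_theory.

Lemma min_matching_cost_le (R : realType) (d n : nat) (A B : 'I_n -> 'rV[R]_d) s :
  min_matching_cost A B <= matching_cost A B s.
Proof. by rewrite /min_matching_cost; exact: bigmin_le_cond. Qed.

Lemma matching_cost_ge0 (R : realType) (d n : nat) (A B : 'I_n -> 'rV[R]_d) s :
  0 <= matching_cost A B s.
Proof. by rewrite sumr_ge0// => i _; exact: enorm_ge0. Qed.

Lemma min_matching_cost_ge0 (R : realType) (d n : nat) (A B : 'I_n -> 'rV[R]_d) :
  0 <= min_matching_cost A B.
Proof.
by rewrite /min_matching_cost; apply: le_bigmin => [|s _]; exact: matching_cost_ge0.
Qed.

(** * The point sets and their projections *)

Section construction.
Variable R : realType.
Implicit Types n k : nat.

(* The halving makes the anchors [2 j] and [2 j + 1] identically distributed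
   after projection. *)
Definition spread n k : R := (n%:R / (k./2).+1%:R) ^+ 2.

(** Each anchor has its own axis, and axis [ord0] is kept for the unit direction, so distinct
    anchors are projected by distinct rows of the matrix, which are independent in the Gaussian
    case. *)
Definition anchor n (i : 'I_n) : 'rV[R]_(n.+1) :=
  spread n i *: delta_mx ord0 (lift ord0 i).

(** The parity decides which end of the pair carries the unit vector, so that it cancels in
    [pointA i - pointB k] when [i] and [k] have opposite parities. *)
Definition pointA n (i : 'I_n) : 'rV[R]_(n.+1) :=
  anchor i + (odd i)%:R *: delta_mx ord0 ord0.

Definition pointB n (i : 'I_n) : 'rV[R]_(n.+1) :=
  anchor i + (~~ odd i)%:R *: delta_mx ord0 ord0.

Lemma spread_double n k : spread n k.*2 = spread n k.*2.+1.
Proof. by rewrite /spread doubleK /= uphalf_double. Qed.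

Lemma spread_ge0 n k : 0 <= spread n k. Proof. exact: sqr_ge0. Qed.

Lemma spread_gt0 n (i : 'I_n) : 0 < spread n i.
Proof. by rewrite exprn_gt0// divr_gt0// ltr0n (leq_ltn_trans _ (ltn_ord i)). Qed.

Lemma spread_ge n h k : (k < n %/ h)%N -> (h ^ 2)%:R <= spread n k.
Proof.
move=> kn; rewrite natrX /spread lerXn2r ?nnegrE ?divr_ge0//.
rewrite ler_pdivlMr// -natrM ler_nat mulnC.
by apply: leq_trans (leq_trunc_div n h); rewrite leq_mul2r; lia.
Qed.

Lemma spread_le n h k : (0 < h)%N -> (n %/ h <= k)%N ->
  spread n k <= ((2 * h) ^ 2)%:R.
Proof.
move=> h0 nk; rewrite natrX /spread lerXn2r ?nnegrE ?divr_ge0//.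
rewrite ler_pdivrMr// -natrM ler_nat.
have := ltn_ceil n h0 => nh; apply: (leq_trans (ltnW nh)).
(* The halving in [spread] is paid for by the factor 2. *)
have hk : ((n %/ h).+1 <= 2 * (k./2).+1)%N by move: nk; lia.
by rewrite mulnAC leq_mul2r hk orbT.
Qed.

Lemma pointAB_coord n (i k l : 'I_n) :
  (pointA i - pointB k) ord0 (lift ord0 l) =
  spread n i * (i == l)%:R - spread n k * (k == l)%:R.
Proof.
by rewrite !mxE !eqxx /= !(inj_eq lift_inj) ?mulr0 ?addr0 ![l == _]eq_sym.
Qed.

Lemma pointA_coord n (i l : 'I_n) :
  pointA i ord0 (lift ord0 l) = spread n i * (i == l)%:R.
Proof.
by rewrite !mxE !eqxx /= (inj_eq lift_inj) ?mulr0 ?addr0 [l == _]eq_sym.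
Qed.

Lemma pointB_coord n (i l : 'I_n) :
  pointB i ord0 (lift ord0 l) = spread n i * (i == l)%:R.
Proof.
by rewrite !mxE !eqxx /= (inj_eq lift_inj) ?mulr0 ?addr0 [l == _]eq_sym.
Qed.

Lemma pointA_inj n : injective (@pointA n).
Proof.
move=> i k /(congr1 (fun x : 'rV_n.+1 => x ord0 (lift ord0 i))).
rewrite !pointA_coord eqxx mulr1; case: eqVneq => // _ /eqP.
by rewrite mulr0 gt_eqF// spread_gt0.
Qed.

Lemma pointB_inj n : injective (@pointB n).
Proof.
move=> i k /(congr1 (fun x : 'rV_n.+1 => x ord0 (lift ord0 i))).
rewrite !pointB_coord eqxx mulr1; case: eqVneq => // _ /eqP.
by rewrite mulr0 gt_eqF// spread_gt0.
Qed.

(** On the axis of [i] the second point vanishes. *)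
Lemma enorm_pointAB_far n (i k : 'I_n) : i != k ->
  spread n i <= enorm (pointA i - pointB k).
Proof.
move=> ik; apply: le_trans (coord_le_enorm _ (lift ord0 i)).
rewrite pointAB_coord eqxx [k == i]eq_sym (negbTE ik) mulr0 subr0 mulr1.
exact: ler_norm.
Qed.

Lemma pointAB_same n (i : 'I_n) :
  pointA i - pointB i = (-1) ^+ (~~ odd i) *: delta_mx ord0 ord0.
Proof.
rewrite /pointA /pointB opprD addrACA subrr add0r -scalerBl.
by case: (odd i); rewrite /= ?subr0 ?sub0r.
Qed.

Lemma pointAB_opposite n (i k : 'I_n) : odd k = ~~ odd i ->
  pointA i - pointB k = anchor i - anchor k.
Proof.
by move=> ik; rewrite /pointA /pointB ik negbK opprD addrACA subrr addr0.
Qed.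

Lemma min_matching_cost_points n : min_matching_cost (@pointA n) (@pointB n) <= n%:R.
Proof.
apply: le_trans (min_matching_cost_le _ _ 1%g) _.
rewrite /matching_cost (eq_bigr (fun=> 1)); first by rewrite sumr_const card_ord.
move=> i _; rewrite perm1 pointAB_same enorm_sign /enorm (bigD1 ord0)//=.
rewrite big1 ?addr0 => [|j j0]; first by rewrite mxE !eqxx expr1n sqrtr1.
by rewrite mxE (negbTE j0) andbF expr0n.
Qed.

Lemma pullback_ge n (s : 'S_n) :
  \sum_(i | s i != i) spread n i <= matching_cost (@pointA n) (@pointB n) s.
Proof.
rewrite /matching_cost [leRHS](bigID (fun i => s i != i)) /=.
rewrite ler_wpDr ?sumr_ge0// => [i _|]; first exact: enorm_ge0.
by apply: ler_sum => i si; rewrite enorm_pointAB_far// eq_sym.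
Qed.

Section projection.
Variables (n m : nat) (W : 'M[R]_(n.+1, m)).

Lemma project_subE (i k : 'I_n) :
  project W (@pointA n) i - project W (@pointB n) k = (pointA i - pointB k) *m W.
Proof. by rewrite /project mulmxBl. Qed.

Lemma project_same (i : 'I_n) :
  enorm (project W (@pointA n) i - project W (@pointB n) i) = enorm (row ord0 W).
Proof. by rewrite project_subE pointAB_same -scalemxAl enorm_sign -rowE. Qed.

Lemma project_opposite (i k : 'I_n) j : odd k = ~~ odd i ->
  (project W (@pointA n) i - project W (@pointB n) k) ord0 j =
  spread n i * W (lift ord0 i) j - spread n k * W (lift ord0 k) j.
Proof.
move=> ik; rewrite project_subE pointAB_opposite// /anchor mulmxBl -!scalemxAl.
by rewrite -!rowE !mxE.
Qed.

(** The anchor cancels within a pair, so each fixed index costs exactly the length of the image of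
    the unit direction. *)
Lemma fixed_le_cost (s : 'S_n) :
  #|[set i | s i == i]%SET|%:R * enorm (row ord0 W) <=
  matching_cost (project W (@pointA n)) (project W (@pointB n)) s.
Proof.
rewrite /matching_cost [leRHS](bigID (fun i => s i == i)) /=.
rewrite ler_wpDr ?sumr_ge0// => [i _|]; first exact: enorm_ge0.
rewrite (eq_bigr (fun=> enorm (row ord0 W))) => [|i /eqP ->]; last exact: project_same.
by rewrite sumr_const mulr_natl cardsE.
Qed.

End projection.

End construction.

(** * Unit cells and their number *)

Section cells.
Context (R : realType) (m N : nat).
Implicit Types y : 'I_m -> R.

(* A code records the sign and the integer part of the absolute value of each
   coordinate.  Bounding the sum of the integer parts, rather than each of them,
   is what keeps the number of codes exponential in [m]. *)
Definition cell_code := {q : {ffun 'I_m -> bool * 'I_(N * m).+1} |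
  (\sum_j (q j).2 <= N * m)%N}.

Definition has_code (b : bool) (k : nat) : set R :=
  [set x | (0 <= x) = b /\ k%:R <= `|x| < k.+1%:R].

Definition in_cell y (q : cell_code) : bool :=
  [forall j, `[< has_code (val q j).1 (val q j).2 (y j) >]].

(** At most one code fits, so the choice made by [pick] is immaterial; [None] marks the points whose
    integer parts add up to more than [N * m]. *)
Definition cell y : option cell_code := [pick q | in_cell y q].

Lemma has_codeP b k x : has_code b k x <-> (0 <= x) = b /\ Num.truncn `|x| = k.
Proof.
have e : k%:R <= `|x| < k.+1%:R <-> Num.truncn `|x| = k.
  split=> [h|<-]; last exact: truncn_itv.
  exact: truncn_def.
by split=> -[xb /e xk]; split.
Qed.

Lemma measurable_has_code b k : measurable (has_code b k).
Proof.
rewrite /has_code.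
apply: (@measurableI _ _ [set x : R | (0 <= x) = b]
  [set x : R | k%:R <= `|x| < k.+1%:R]).
  have := measurable_fun_ler (measurable_cst (0 : R)) (@measurable_id _ R setT).
  by move=> /(_ measurableT [set b]); rewrite setTI; exact.
have := @normr_measurable R setT measurableT `[k%:R, k.+1%:R[%classic (measurable_itv _).
by rewrite setTI; congr measurable; apply/seteqP; split => x /=; rewrite in_itv.
Qed.

Lemma in_cellP y (q : cell_code) : reflect
  (forall j, has_code (val q j).1 (val q j).2 (y j)) (in_cell y q).
Proof. by apply: (iffP forallP) => h j; apply/asboolP; exact: h. Qed.

Lemma cell_Some y (q : cell_code) : (cell y == Some q) = in_cell y q.
Proof.
rewrite /cell; case: pickP => [q' yq'|no]; last by rewrite no.
apply/eqP/idP => [[<-]//|yq]; congr Some; apply: val_inj; apply/ffunP => j.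
move/in_cellP/(_ j)/has_codeP: yq => -[e1 e2].
move/in_cellP/(_ j)/has_codeP: yq' => -[e1' e2'].
case: (val q j) (val q' j) e1 e2 e1' e2' => [b k] [b' k'] /= <- e <- e'.
by congr pair; apply: val_inj; rewrite /= -e -e'.
Qed.

Lemma cell_None y : cell y = None -> (N * m)%:R < \sum_j `|y j|.
Proof.
rewrite /cell; case: pickP => // no _; rewrite ltNge; apply/negP => ysum.
have ktot : (\sum_j Num.truncn `|y j| <= N * m)%N.
  rewrite -(ler_nat R) natr_sum (le_trans _ ysum)// ler_sum// => j _.
  by rewrite truncn_le.
have kj j : (Num.truncn `|y j| < (N * m).+1)%N.
  by rewrite ltnS (leq_trans _ ktot)// (bigD1 j)//= leq_addr.
pose q0 : {ffun 'I_m -> bool * 'I_(N * m).+1} := [ffun j => (0 <= y j, Ordinal (kj j))].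
have q0P : (\sum_j (q0 j).2 <= N * m)%N.
  by rewrite (eq_bigr (fun j => Num.truncn `|y j|))// => j _; rewrite ffunE.
have /in_cellP[] := no (exist _ q0 q0P) => j; apply/has_codeP => /=.
by rewrite ffunE.
Qed.

(** Equal integer parts of the absolute values bound the difference by 1 because the signs agree as
    well. *)
Lemma cell_close y y' q j : cell y = Some q -> cell y' = Some q ->
  `|y j - y' j| <= 1.
Proof.
move=> /eqP; rewrite cell_Some => /in_cellP/(_ j)[e1 /andP[e2 e3]].
move=> /eqP; rewrite cell_Some => /in_cellP/(_ j)[f1 /andP[f2 f3]].
have e0 : (0 <= y j) = (0 <= y' j) by rewrite e1 f1.
rewrite -natr1 in e3 f3; rewrite ler_norml; move: e0.
have [y0|y0] := lerP 0 (y j); have [y'0|y'0] := lerP 0 (y' j) => // _.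
  by move: e2 e3 f2 f3; rewrite !ger0_norm//; lra.
by move: e2 e3 f2 f3; rewrite !ltr0_norm//; lra.
Qed.

(** Give a code the weight [2 ^ (N m)] times the product of the [2 ^ (- k_j)], with [k_j] its
    integer parts; every admissible code has weight at least 1. The sum over all codes factors over
    the coordinates, and each factor is at most 4: two signs times a geometric series bounded by
    2. *)
Lemma card_code : #|{: cell_code}|%:R <= ((2 ^+ (N + 2)) ^+ m : R).
Proof.
have w2 : \sum_(x : bool * 'I_(N * m).+1) (2^-1 : R) ^+ x.2 <= 4.
  rewrite -(pair_big predT predT
    (fun (_ : bool) (k : 'I_(N * m).+1) => (2^-1 : R) ^+ k)) /=.
  rewrite big_bool /=.
  have : \sum_(k < (N * m).+1) (2^-1 : R) ^+ k <= 2.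
    have := subrX1 (2^-1 : R) (N * m).+1 => e.
    have p0 : 0 <= (2^-1 : R) ^+ (N * m).+1 by rewrite exprn_ge0 ?invr_ge0.
    by move: e; set S := \sum_(k < _) _ => e; nra.
  by lra.
rewrite card_sig -sum1_card natr_sum.
pose f (q : {ffun 'I_m -> bool * 'I_(N * m).+1}) : R :=
  2 ^+ (N * m) * \prod_j (2^-1 : R) ^+ (q j).2.
have f0 q : 0 <= f q.
  by rewrite mulr_ge0 ?exprn_ge0 ?prodr_ge0// => j _; rewrite exprn_ge0 ?invr_ge0.
apply: (@le_trans _ _ (\sum_q f q)).
  rewrite [leRHS](bigID (fun q : {ffun 'I_m -> bool * 'I_(N * m).+1} =>
    (\sum_j (q j).2 <= N * m)%N)) /=.
  rewrite ler_wpDr ?sumr_ge0//; apply: ler_sum => q; rewrite inE => qs.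
  rewrite /f prodrXr exprVn ler_pdivlMr ?exprn_gt0// mul1r.
  by rewrite ler_weXn2l ?ler1n.
rewrite -mulr_sumr -(bigA_distr_bigA
  (fun (_ : 'I_m) (x : bool * 'I_(N * m).+1) => (2^-1 : R) ^+ x.2)).
rewrite prodr_const card_ord exprD exprMn -exprM ler_pM2l ?exprn_gt0//.
have S0 : 0 <= \sum_(x : bool * 'I_(N * m).+1) (2^-1 : R) ^+ x.2.
  by rewrite sumr_ge0// => k _; rewrite exprn_ge0 ?invr_ge0.
by rewrite lerXn2r ?nnegrE// (le_trans w2)//; lra.
Qed.

End cells.

(** * Deterministic lower bound on the pull-back cost *)

Section deterministic_bound.
Context (R : realType) (n m : nat) (W : 'M[R]_(n.+1, m)).
Hypothesis m0 : (0 < m)%N.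

(** The image of anchor [i], enlarged so that a unit cell has side [delta / sqrt m], hence Euclidean
    diameter at most [delta], in the original scale. *)
Definition scaled (delta : R) (i : 'I_n) (j : 'I_m) : R :=
  Num.sqrt m%:R / delta * spread R n i * W (lift ord0 i) j.

Let sqrtm0 : 0 < Num.sqrt m%:R :> R. Proof. by rewrite sqrtr_gt0 ltr0n. Qed.

Let sqrtmK : Num.sqrt m%:R * Num.sqrt m%:R = m%:R :> R.
Proof. by rewrite -expr2 sqr_sqrtr. Qed.

Lemma card_below (k : nat) : (k <= n)%N -> #|[set i : 'I_n | (i < k)%N]%SET| = k.
Proof.
move=> kn; rewrite -sum1_card (eq_bigl (fun i : 'I_n => (i < k)%N)) => [|i];
  last by rewrite inE.
by rewrite -(big_ord_widen _ (fun=> 1%N) kn) sum1_card card_ord.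
Qed.

(** The first [n / h] indices are given up. Beyond them [spread] is at most [(2 h)^2], so an uncoded
    index needs a row of large absolute sum, and the total of these sums is bounded. *)
Lemma card_uncoded_le (h N : nat) (delta T : R) :
  (0 < h)%N -> (0 < N)%N -> 0 < delta ->
  \sum_(i < n) \sum_(j < m) `|W (lift ord0 i) j| <= T * n%:R * Num.sqrt m%:R ->
  #|[set i | cell N (scaled delta i) == None]%SET|%:R <=
    n%:R / h%:R + ((2 * h) ^ 2)%:R * T / (delta * N%:R) * n%:R.
Proof.
move=> h0 N0 d0 WT.
have N0' : 0 < N%:R :> R by rewrite ltr0n.
have h0' : 0 < h%:R :> R by rewrite ltr0n.
pose S i := \sum_(j < m) `|W (lift ord0 i) j|.
have S0 i : 0 <= S i by rewrite sumr_ge0.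
(* The weight for which [a * S i] is at least 1 at every uncoded index beyond the first [n / h]. *)
pose a : R := ((2 * h) ^ 2)%:R / (delta * N%:R * Num.sqrt m%:R).
have a0 : 0 <= a by rewrite divr_ge0// !mulr_ge0// ltW.
apply: (@le_trans _ _ (\sum_(i < n) ((i < n %/ h)%N%:R + a * S i))).
  rewrite -sum1_card natr_sum big_mkcond /=; apply: ler_sum => i _.
  rewrite inE; case: ifPn => [/eqP/cell_None hi|_]; last by rewrite addr_ge0// mulr_ge0.
  have [ih|ih] := ltnP i (n %/ h); first by rewrite lerDl mulr_ge0.
  rewrite add0r /a -mulrAC ler_pdivlMr ?mulr_gt0// mul1r.
  have e : \sum_j `|scaled delta i j| = Num.sqrt m%:R / delta * spread R n i * S i.
    rewrite mulr_sumr; apply: eq_bigr => j _; rewrite /scaled normrM; congr (_ * _).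
    by rewrite ger0_norm// mulr_ge0 ?spread_ge0// divr_ge0// ltW.
  have mE : (N * m)%:R = N%:R * (Num.sqrt m%:R * Num.sqrt m%:R) :> R.
    by rewrite natrM sqrtmK.
  rewrite e mE in hi.
  have hi2 : N%:R * Num.sqrt m%:R < spread R n i * S i / delta.
    rewrite -(ltr_pM2r sqrtm0) -[ltLHS]mulrA (lt_le_trans hi)// le_eqVlt.
    by apply/orP; left; apply/eqP; field; rewrite gt_eqF.
  move/ltW: hi2; rewrite ler_pdivlMr// => hi2.
  by rewrite -mulrA mulrC (le_trans hi2)// ler_wpM2r// spread_le.
rewrite big_split /= -mulr_sumr lerD//.
  rewrite -natr_sum ler_pdivlMr// -natrM ler_nat.
  apply: leq_trans (leq_trunc_div n h); rewrite leq_mul2r; apply/orP; right.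
  by rewrite -big_mkcond sum1_card -[leqRHS](card_below (leq_div n h)) cardsE.
apply: le_trans (ler_wpM2l a0 WT) _.
rewrite le_eqVlt; apply/orP; left; apply/eqP; rewrite /a; field.
by rewrite !gt_eqF.
Qed.

(** For a moved index the unit vectors cancel and the two anchors share a cell: each coordinate
    differs by at most [delta / sqrt m], hence the norm by at most [delta]. *)
Lemma cell_perm_cost_le (N : nat) (delta : R) (s : 'S_n) : 0 < delta ->
  (forall i, s i != i ->
     [/\ cell N (scaled delta i) != None,
         cell N (scaled delta (s i)) = cell N (scaled delta i) &
         odd (s i) = ~~ odd i]) ->
  matching_cost (project W (@pointA R n)) (project W (@pointB R n)) s <=
  #|[set i | s i == i]%SET|%:R * enorm (row ord0 W) + n%:R * delta.
Proof.
move=> d0 sP; rewrite /matching_cost (bigID (fun i => s i == i)) /=; apply: lerD.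
  rewrite (eq_bigr (fun=> enorm (row ord0 W))) => [|i /eqP ->]; last exact: project_same.
  by rewrite sumr_const mulr_natl cardsE.
apply: (@le_trans _ _ (\sum_(i | s i != i) delta)); last first.
  rewrite sumr_const -[leLHS]mulr_natl ler_pM2r// ler_nat.
  by rewrite -[leqRHS](card_ord n) max_card.
apply: ler_sum => i /sP[ci cs os].
have -> : delta = Num.sqrt m%:R * (delta / Num.sqrt m%:R).
  by rewrite mulrCA divff ?mulr1// gt_eqF.
apply: enorm_le_coord => [|j]; first by rewrite divr_ge0// ltW.
rewrite project_opposite//.
case e : (cell N (scaled delta i)) ci cs => [q|]// _ cs.
have := cell_close j e cs.
have -> : scaled delta i j - scaled delta (s i) j = Num.sqrt m%:R / delta *
    (spread R n i * W (lift ord0 i) j - spread R n (s i) * W (lift ord0 (s i)) j).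
  by rewrite /scaled; ring.
rewrite normrM [X in X * _]ger0_norm; last by rewrite divr_ge0// ltW.
by rewrite mulrAC ler_pdivrMr// mul1r ler_pdivlMr// mulrC.
Qed.

(** At least [n / (2 h)] indices lie below [n %/ h] and at most [n / (4 h)] of them are fixed. The
    remaining ones, at least [n / (4 h)], cost at least [h^2] each. *)
Lemma fixed_le_pullback (h : nat) (c : R) (s : 'S_n) :
  (0 < h)%N -> (2 * h <= n)%N -> c < h%:R / 4 * n%:R ->
  #|[set i | s i == i]%SET|%:R <= n%:R / (4 * h%:R) :> R ->
  c < matching_cost (@pointA R n) (@pointB R n) s.
Proof.
move=> h0 hn cn fs; apply: lt_le_trans cn (le_trans _ (pullback_ge R s)).
have h0' : 0 < h%:R :> R by rewrite ltr0n.
pose k := (n %/ h)%N; pose K := #|[set i : 'I_n | (i < k)%N && (s i != i)]%SET|.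
have kK : (k <= K + #|[set i | s i == i]%SET|)%N.
  rewrite -[leqLHS](card_below (leq_div n h)) -/k.
  rewrite -(cardsID [set i | s i == i]%SET [set i : 'I_n | (i < k)%N]%SET) addnC.
  apply: leq_add; apply/subset_leq_card/fintype.subsetP => i; rewrite !inE.
    by rewrite andbC.
  by case/andP.
have nk : n%:R <= 2 * h%:R * k%:R :> R.
  rewrite -!natrM ler_nat; have := ltn_ceil n h0; rewrite -/k => nk.
  have k1 : (2 <= k)%N by rewrite leq_divRL.
  by move: nk k1; nia.
apply: (@le_trans _ _ ((h ^ 2)%:R * K%:R)).
  have kK' : k%:R <= K%:R + n%:R / (4 * h%:R) :> R.
    by apply: le_trans (lerD (lexx _) fs); rewrite -natrD ler_nat.
  have e : n%:R / (4 * h%:R) * (4 * h%:R) = n%:R :> R.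
    by rewrite divfK// gt_eqF// mulr_gt0.
  rewrite natrX expr2; set x := n%:R / (4 * h%:R) in kK' e.
  have : x <= K%:R by nra.
  by rewrite -{1}e; nra.
rewrite [leRHS](bigID (fun i : 'I_n => (i < k)%N)) /=.
rewrite ler_wpDr ?sumr_ge0// => [i _|]; first exact: spread_ge0.
apply: (@le_trans _ _ (\sum_(i < n | (s i != i) && (i < k)%N) (h ^ 2)%:R)).
  rewrite sumr_const -[leRHS]mulr_natr ler_wpM2l// ler_nat.
  apply: eq_leq; apply: eq_card => i.
  by rewrite !inE andbC.
by apply: ler_sum => i /andP[_ ik]; exact: spread_ge.
Qed.

(** The optimal projected matching is compared with the permutation that swaps inside cells: its
    fixed indices alone must not cost more than that permutation. *)
Lemma pullback_cost_large (h N : nat) (kappa T c : R) :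
  let delta := kappa / (16 * h%:R) in
  (0 < h)%N -> (0 < N)%N -> 0 < kappa -> (2 * h <= n)%N ->
  c < h%:R / 4 * n%:R ->
  ((2 * (16 * h)) ^ 2)%:R * T / (delta * N%:R) <= (16 * h%:R)^-1 ->
  kappa <= enorm (row ord0 W) ->
  \sum_(i < n) \sum_(j < m) `|W (lift ord0 i) j| <= T * n%:R * Num.sqrt m%:R ->
  \sum_(q : cell_code m N) `|\sum_(i < n | cell N (scaled delta i) == Some q)
     ((-1) ^+ odd i : R)| <= n%:R / (16 * h%:R) ->
  pullback_cost_gt (@pointA R n) (@pointB R n) W c.
Proof.
move=> delta h0 N0 k0 hn cn NT kv WT Dq s0 opt.
have h0' : 0 < h%:R :> R by rewrite ltr0n.
have d0 : 0 < delta by rewrite divr_gt0// mulr_gt0.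
apply: (fixed_le_pullback h0 hn cn).
have [s [sP sfix]] := exists_cell_perm R
  (fun i => cell N (scaled delta i)) (fun i : 'I_n => odd i).
have h16 : (0 < 16 * h)%N by rewrite muln_gt0.
have unc := card_uncoded_le h16 N0 d0 WT.
have c1 := fixed_le_cost W s0; rewrite opt in c1.
have c2 := le_trans c1 (le_trans (min_matching_cost_le _ _ s) (cell_perm_cost_le d0 sP)).
set v := enorm _ in kv c2 *; set F := _%:R in sfix c2; set f := _%:R in c2 *.
have v0 : 0 < v by apply: lt_le_trans kv.
(* The budget is [4 x]: uncoded indices take [2 x], the imbalance of the cells [x], and the swaps,
   at [delta] each, the last [x]. *)
set x : R := n%:R / (16 * h%:R).
have n0 : 0 <= n%:R :> R by [].
have Fx : F <= 3 * x.
  apply: le_trans sfix _; rewrite (_ : 3 * x = (x + x) + x); last by ring.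
  rewrite lerD// (le_trans unc)// natrM lerD// /x mulrC ler_wpM2l//.
have dx : n%:R * delta <= x * v.
  by rewrite /delta mulrCA mulrC ler_wpM2l// divr_ge0// mulr_ge0// ltW.
have -> : n%:R / (4 * h%:R) = 4 * x by rewrite /x; field; rewrite gt_eqF.
have fv : f * v <= (4 * x) * v by nra.
by rewrite -(ler_pM2r v0).
Qed.

End deterministic_bound.

(** * Measurability of the pull-back event *)

Lemma optimal_matchingP (R : realType) (d n : nat) (A B : 'I_n -> 'rV[R]_d) s :
  optimal_matching A B s <->
  (forall t, matching_cost A B s <= matching_cost A B t).
Proof.
split=> [-> t|h]; first exact: min_matching_cost_le.
apply/eqP; rewrite eq_le min_matching_cost_le andbT.
by apply: le_bigmin => [|t _]; exact: h.
Qed.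

Section random_projection.
Context (R : realType) (disp : measure_display) (T : measurableType disp).
Variable P : probability T R.

Section measurability.
Variables (d m n : nat) (G : 'I_d * 'I_m -> {RV P >-> R}).
Variables A B : 'I_n -> 'rV[R]_d.

Lemma measurable_projected_cost (s : 'S_n) : measurable_fun setT (fun w =>
  matching_cost (project (random_mx G w) A) (project (random_mx G w) B) s).
Proof.
apply: measurable_sum => i; rewrite /enorm.
apply: (measurableT_comp (f := @Num.sqrt R)).
  by apply: continuous_measurable_fun; exact: sqrt_continuous.
apply: measurable_sum => j; apply: measurable_funX.
rewrite (_ : (fun w => _) = (fun w =>
    \sum_l (A i - B (s i)) ord0 l * G (l, j) w)); last first.
  apply/funext => w; rewrite /project -mulmxBl mxE; apply: eq_bigr => l _.
  by rewrite [random_mx _ _ _ _]mxE.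
by apply: measurable_sum => l; apply: measurable_funM.
Qed.

(** The event says that no matching of cost at most [c] is optimal after projection; optimality is a
    finite set of inequalities between measurable costs. *)
Lemma measurable_pullback_cost_gt (c : R) :
  measurable [set w | pullback_cost_gt A B (random_mx G w) c].
Proof.
pose cost w s := matching_cost (project (random_mx G w) A) (project (random_mx G w) B) s.
have -> : [set w | pullback_cost_gt A B (random_mx G w) c] =
    \bigcap_(s in [set s | ~~ (c < matching_cost A B s)])
      ~` (\bigcap_(t in [set: 'S_n]) [set w | cost w s <= cost w t]).
  apply/seteqP; split => w /=.
    move=> h s /= cs opt; move/negP: cs; apply; apply: h.
    by apply/optimal_matchingP => t; exact: opt.
  move=> h s /optimal_matchingP opt; apply/negPn/negP => cs.
  by apply: (h s cs) => t _; exact: opt.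
apply: fin_bigcap_measurable => [|s _]; first exact: finite_finset.
apply: measurableC; apply: fin_bigcap_measurable => [|t _]; first exact: finite_finset.
have := measurable_fun_ler (measurable_projected_cost s) (measurable_projected_cost t).
by move=> /(_ measurableT [set true]); rewrite setTI; exact.
Qed.

End measurability.

(** * Tail bounds for the Gaussian matrix *)

Section gaussian.
Variables (n m : nat) (G : 'I_n.+1 * 'I_m -> {RV P >-> R}).
Hypothesis m0 : (0 < m)%N.
Hypothesis gaussG : gaussian_projection G.

Let sqrtm0 : 0 < Num.sqrt m%:R :> R. Proof. by rewrite sqrtr_gt0 ltr0n. Qed.

Let sqrtmK : Num.sqrt m%:R * Num.sqrt m%:R = m%:R :> R.
Proof. by rewrite -expr2 sqr_sqrtr. Qed.

Let sigma0 : 0 < (Num.sqrt m%:R)^-1 :> R. Proof. by rewrite invr_gt0. Qed.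

Definition total_abs (w : T) : R := \sum_(i < n) \sum_(j < m) `|G (lift ord0 i, j) w|.

Lemma measurable_total_abs : measurable_fun setT total_abs.
Proof.
apply: measurable_sum => i; apply: measurable_sum => j.
by apply: measurableT_comp => //; exact: normr_measurable.
Qed.

(** Each of the [n m] entries has absolute moment at most [2 / sqrt m], so the total has mean at
    most [2 n sqrt m]. *)
Lemma total_abs_tail (t : R) : (0 < n)%N -> 0 < t ->
  (P [set w | (t * n%:R * Num.sqrt m%:R <= total_abs w)%R] <= (2 / t)%:E)%E.
Proof.
move=> n0 t0; have n0' : 0 < n%:R :> R by rewrite ltr0n.
have mabs ij : measurable_fun setT (fun w => `|G ij w|).
  by apply: measurableT_comp => //; exact: normr_measurable.
have -> : 2 / t = (2 * n%:R * Num.sqrt m%:R) / (t * n%:R * Num.sqrt m%:R).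
  by field; rewrite !gt_eqF.
apply: ge0_markov => //; first exact: measurable_total_abs.
- by move=> w; rewrite sumr_ge0// => i _; rewrite sumr_ge0.
- by rewrite !mulr_gt0.
rewrite /total_abs; under eq_integral do rewrite -sumEFin.
rewrite ge0_integral_sum//=; last 2 first.
- by move=> i; apply/measurable_EFinP; exact: measurable_sum.
- by move=> i w _; rewrite lee_fin sumr_ge0.
apply: (@le_trans _ _ (\sum_(i < n) (2 * Num.sqrt m%:R)%:E)%E); last first.
  by rewrite sumEFin lee_fin sumr_const card_ord -[leLHS]mulr_natr mulrAC.
apply: lee_sum => i _; under eq_integral do rewrite -sumEFin.
rewrite ge0_integral_sum//=; last by move=> j; apply/measurable_EFinP.
apply: (@le_trans _ _ (\sum_(j < m) (2 * (Num.sqrt m%:R)^-1)%:E)%E); last first.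
  rewrite sumEFin lee_fin sumr_const card_ord -[leLHS]mulr_natr -[X in _ * X]sqrtmK.
  by rewrite -mulrA mulKf// gt_eqF.
by apply: lee_sum => j _; apply: normal_abs_moment => //; exact: gaussG.2.
Qed.

(* If the image of the unit direction is shorter than [kappa], at least half of
   its coordinates are small; Markov's inequality for their number gives an
   anti-concentration bound that is uniform in [m]. *)
Definition small_coords (kappa : R) (w : T) : R :=
  \sum_(j < m) \1_[set w | `|G (ord0, j) w| < 2 * kappa / Num.sqrt m%:R] w.

Let measurable_small (r : R) ij : measurable [set w | `|G ij w| < r].
Proof.
have mG : measurable_fun setT (fun w => `|G ij w|).
  by apply: measurableT_comp => //; exact: normr_measurable.
have := measurable_fun_ltr mG (measurable_cst r).
by move=> /(_ measurableT [set true]); rewrite setTI; exact.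
Qed.

Lemma measurable_small_coords kappa : measurable_fun setT (small_coords kappa).
Proof. by apply: measurable_sum => j; exact: measurable_indic. Qed.

Lemma small_coords_tail (kappa : R) : 0 < kappa ->
  (P [set w | (m%:R / 2 <= small_coords kappa w)%R] <= (8 * kappa)%:E)%E.
Proof.
move=> k0; have m0' : 0 < m%:R :> R by rewrite ltr0n.
(* A coordinate is small with probability at most [4 kappa], so the mean number is at most
   [4 kappa m]; the threshold is [m / 2]. *)
have -> : 8 * kappa = (4 * kappa * m%:R) / (m%:R / 2) by field; rewrite gt_eqF.
apply: ge0_markov; first exact: measurable_small_coords.
- by move=> w; rewrite sumr_ge0.
- by rewrite divr_gt0.
rewrite /small_coords; under eq_integral do rewrite -sumEFin.
rewrite ge0_integral_sum//=; last first.
  by move=> j; apply/measurable_EFinP; exact: measurable_indic.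
apply: (@le_trans _ _ (\sum_(j < m) (4 * kappa)%:E)%E); last first.
  by rewrite sumEFin lee_fin sumr_const card_ord -[leLHS]mulr_natr.
apply: lee_sum => j _; rewrite integral_indic// setIT.
have -> : 4 * kappa = 2 * (2 * kappa / Num.sqrt m%:R) / (Num.sqrt m%:R)^-1.
  by field; rewrite gt_eqF.
apply: normal_small_ball => //; first exact: gaussG.2.
by rewrite divr_ge0 ?mulr_ge0// ltW.
Qed.

(** More than [m / 2] coordinates have square at least [4 kappa^2 / m], so the squared norm exceeds
    [kappa^2]. *)
Lemma small_coords_enorm (kappa : R) w : 0 < kappa ->
  small_coords kappa w < m%:R / 2 -> kappa <= enorm (row ord0 (random_mx G w)).
Proof.
move=> k0 sm; have m0' : 0 < m%:R :> R by rewrite ltr0n.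
rewrite /enorm -[leLHS](ger0_norm (ltW k0)) -sqrtr_sqr ler_wsqrtr//.
pose r : R := 2 * kappa / Num.sqrt m%:R.
have r0 : 0 <= r by rewrite divr_ge0 ?mulr_ge0// ltW.
have r2 : r ^+ 2 * m%:R = 4 * kappa ^+ 2.
  by rewrite /r expr_div_n sqr_sqrtr// divfK ?gt_eqF//; ring.
have e : \sum_(j < m) r ^+ 2 * (1 - \1_[set w | `|G (ord0, j) w| < r] w) =
    r ^+ 2 * (m%:R - small_coords kappa w).
  rewrite -mulr_sumr sumrB sumr_const card_ord; congr (_ * (_ - _)).
apply: (@le_trans _ _ (r ^+ 2 * (m%:R - small_coords kappa w))); last first.
  rewrite -e; apply: ler_sum => j _; rewrite !mxE indicE.
  have [Gr|Gr] := ltrP `|G (ord0, j) w| r.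
    by rewrite mem_set// subrr mulr0 sqr_ge0.
  rewrite memNset ?subr0 ?mulr1/=; last by move: Gr; rewrite leNgt => /negP.
  by rewrite -[leRHS]real_normK ?num_real// lerXn2r ?nnegrE.
by have := sqr_ge0 r; have := sqr_ge0 kappa; nra.
Qed.

(** * Imbalance between even and odd anchors in a cell *)

Section imbalance.
Variables (N : nat) (delta : R).

Let cell_event (q : cell_code m N) (i : 'I_n) : set T :=
  [set w | in_cell (scaled (random_mx G w) delta i) q].

Definition imbalance (q : cell_code m N) (w : T) : R :=
  \sum_(i < n) (-1) ^+ odd i * \1_(cell_event q i) w.

Lemma imbalanceE q w : imbalance q w =
  \sum_(i < n | cell N (scaled (random_mx G w) delta i) == Some q) (-1) ^+ odd i.
Proof.
rewrite [RHS]big_mkcond; apply: eq_bigr => i _; rewrite cell_Some indicE.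
by case: ifPn => h; [rewrite mem_set// mulr1|rewrite memNset ?mulr0//; exact/negP].
Qed.

(** Indexed by a natural number and depending on it only through [spread], so that [2j] and [2j + 1]
    give the same set even when [2j + 1] is not an index. *)
Let cell_slab (q : cell_code m N) (k : nat) (j : 'I_m) : set R :=
  [set x | has_code (val q j).1 (val q j).2 (Num.sqrt m%:R / delta * spread R n k * x)].

Let measurable_cell_slab q k j : measurable (cell_slab q k j).
Proof.
have mf : measurable_fun setT (fun x : R => Num.sqrt m%:R / delta * spread R n k * x).
  exact: measurable_funM.
have := mf measurableT _ (measurable_has_code (val q j).1 (val q j).2).
by rewrite setTI.
Qed.

(** Row [lift ord0 i] has number [i + 1]; the predecessor expresses the event through the row
    number, as the independence of rows requires. *)
Let cell_eventE q (i : 'I_n) : cell_event q i =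
  [set w | forall j, cell_slab q (lift ord0 i).-1 j (G (lift ord0 i, j) w)].
Proof.
apply/seteqP; split => w /=.
  by move=> /in_cellP h j; have := h j; rewrite /scaled mxE.
by move=> h; apply/in_cellP => j; have := h j; rewrite /scaled mxE.
Qed.

Let measurable_cell_event q i : measurable (cell_event q i).
Proof.
rewrite cell_eventE (_ : [set w | _] = \bigcap_(j in setT)
    (G (lift ord0 i, j) @^-1` cell_slab q (lift ord0 i).-1 j)); last first.
  by apply/seteqP; split => w /= h j; [move=> _|]; exact: h.
apply: fin_bigcap_measurable => [|j _]; first exact: finite_finset.
exact: measurable_funPTI.
Qed.

Lemma measurable_imbalance q : measurable_fun setT (imbalance q).
Proof.
by apply: measurable_sum => i; exact: measurable_funM.
Qed.

(** Rows are independent and the anchors [2j] and [2j + 1] have equal probabilities [p] of hitting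
    the cell, so [alternating_indic_sq] applies. *)
Lemma imbalance_sq_le q :
  (\int[P]_w ((imbalance q w) ^+ 2)%:E <= (n.+1%:R)%:E)%E.
Proof.
have [indG normG] := gaussG.
pose p k := fine (\prod_(j < m)
  normal_prob 0 (Num.sqrt m%:R)^-1 (cell_slab q k j))%E.
have pE (i : 'I_n) : P (cell_event q i) = (p i)%:E.
  have e : P (cell_event q i) =
      (\prod_(j < m) normal_prob 0 (Num.sqrt m%:R)^-1 (cell_slab q i j))%E.
    rewrite cell_eventE.
    rewrite (row_event1 (S := fun k j => cell_slab q k.-1 j) indG)//.
    by apply: eq_bigr => j _; exact: normG.
  by rewrite /p -e fineK// fin_num_measure.
apply: (@alternating_indic_sq R _ T P n (cell_event q) p).
- exact: measurable_cell_event.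
- by move=> k; rewrite /p /cell_slab spread_double.
- exact: pE.
- move=> i k ik; rewrite EFinM -!pE !cell_eventE.
  rewrite (row_eventI (S := fun k j => cell_slab q k.-1 j) indG)//.
Qed.

(** Summing the squares over all cells lets one event control every cell at once. *)
Lemma imbalance_tail (t : R) : 0 < t ->
  (P [set w | (t ^+ 2 <= \sum_(q : cell_code m N) imbalance q w ^+ 2)%R] <=
   (#|{: cell_code m N}|%:R * n.+1%:R / t ^+ 2)%:E)%E.
Proof.
move=> t0; have mi q : measurable_fun setT (fun w => imbalance q w ^+ 2).
  by apply: measurable_funX; exact: measurable_imbalance.
apply: ge0_markov; rewrite ?exprn_gt0//; first exact: measurable_sum.
  by move=> w; rewrite sumr_ge0// => q _; exact: sqr_ge0.
under eq_integral do rewrite -sumEFin.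
rewrite ge0_integral_sum//=; last 2 first.
- by move=> q; exact/measurable_EFinP.
- by move=> q w _; rewrite lee_fin sqr_ge0.
rewrite mulr_natl -sumr_const -sumEFin; apply: lee_sum => q _.
exact: imbalance_sq_le.
Qed.

Lemma imbalance_sum_le (t : R) w : 0 < t ->
  \sum_(q : cell_code m N) imbalance q w ^+ 2 < t ^+ 2 ->
  \sum_(q : cell_code m N) `|imbalance q w| <= #|{: cell_code m N}|%:R * t.
Proof.
move=> t0 h; rewrite mulr_natl -sumr_const; apply: ler_sum => q _.
rewrite -ler_sqr ?nnegrE ?(ltW t0)// real_normK ?num_real//.
apply: le_trans (ltW h); rewrite (bigD1 q)//= lerDl sumr_ge0// => k _.
exact: sqr_ge0.
Qed.

End imbalance.

(** * Union bound *)

(** Three bad events cover the failure: large entries in total, a short image of the unit direction,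
    and unbalanced cells. The three error terms bound them in this order. *)
Lemma pullback_probability (h N : nat) (kappa t c : R) :
  let delta := kappa / (16 * h%:R) in
  let K : R := (2 ^+ (N + 2)) ^+ m in
  (0 < h)%N -> (0 < N)%N -> 0 < kappa -> 0 < t -> (2 * h <= n)%N ->
  c < h%:R / 4 * n%:R ->
  ((2 * (16 * h)) ^ 2)%:R * t / (delta * N%:R) <= (16 * h%:R)^-1 ->
  (1 - (2 / t + 8 * kappa + 512 * h%:R ^+ 2 * K ^+ 3 / n%:R)%:E <=
   P [set w | pullback_cost_gt (@pointA R n) (@pointB R n) (random_mx G w) c])%E.
Proof.
move=> delta K h0 N0 k0 t0 hn cn tN.
have n0 : (0 < n)%N by lia.
have n0' : 0 < n%:R :> R by rewrite ltr0n.
have h0' : 0 < h%:R :> R by rewrite ltr0n.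
have K0 : 0 < K by rewrite !exprn_gt0.
have cardK : #|{: cell_code m N}|%:R <= K := card_code R m N.
(* There are at most [K] cells, so an imbalance of at most [u] in each adds up to at most
   [n / (16 h)]. *)
pose u : R := n%:R / (16 * h%:R * K).
have u0 : 0 < u by rewrite divr_gt0// !mulr_gt0.
set good := [set w | _]; have mgood : measurable good.
  exact: measurable_pullback_cost_gt.
pose bad1 := [set w | t * n%:R * Num.sqrt m%:R <= total_abs w].
pose bad2 := [set w | m%:R / 2 <= small_coords kappa w].
pose bad3 := [set w | u ^+ 2 <= \sum_(q : cell_code m N) imbalance delta q w ^+ 2].
have mle (f : T -> R) (x : R) : measurable_fun setT f -> measurable [set w | x <= f w].
  move=> mf; have := measurable_fun_ler (measurable_cst x) mf.
  by move=> /(_ measurableT [set true]); rewrite setTI; exact.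
have mbad1 : measurable bad1 by apply: mle; exact: measurable_total_abs.
have mbad2 : measurable bad2 by apply: mle; exact: measurable_small_coords.
have mbad3 : measurable bad3.
  apply: mle; apply: measurable_sum => q; apply: measurable_funX.
  exact: measurable_imbalance.
have sub : ~` good `<=` bad1 `|` bad2 `|` bad3.
  move=> w /= ngood; apply: contrapT => /not_orP[/not_orP[/negP b1 /negP b2] /negP b3].
  move: b1 b2 b3; rewrite -!ltNge => b1 b2 b3; apply: ngood.
  apply: (pullback_cost_large m0 h0 N0 k0 hn cn tN).
  - exact: small_coords_enorm.
  - move/ltW: b1; apply: le_trans; rewrite le_eqVlt; apply/orP; left; apply/eqP.
    by apply: eq_bigr => i _; apply: eq_bigr => j _; rewrite mxE.
  - rewrite (eq_bigr (fun q => `|imbalance delta q w|)) => [|q _];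
      last by rewrite imbalanceE.
    apply: le_trans (imbalance_sum_le u0 b3) _.
    apply: le_trans (ler_wpM2r (ltW u0) cardK) _.
    by rewrite le_eqVlt; apply/orP; left; apply/eqP; rewrite /u; field; rewrite !gt_eqF.
have Pbad3 : (P bad3 <= (512 * h%:R ^+ 2 * K ^+ 3 / n%:R)%:E)%E.
  apply: le_trans (imbalance_tail _ _ u0) _; rewrite lee_fin.
  apply: (@le_trans _ _ (K * (2 * n%:R) / u ^+ 2)).
    have n2 : n.+1%:R <= 2 * n%:R :> R.
      by rewrite -natrM ler_nat mul2n -addnn -addn1 leq_add2l.
    by rewrite ler_pM2r ?invr_gt0 ?exprn_gt0// ler_pM.
  by rewrite le_eqVlt; apply/orP; left; apply/eqP; rewrite /u; field; rewrite !gt_eqF.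
have Pbad : (P (~` good) <= (2 / t + 8 * kappa + 512 * h%:R ^+ 2 * K ^+ 3 / n%:R)%:E)%E.
  apply: (@le_trans _ _ (P (bad1 `|` bad2 `|` bad3))).
    by apply: le_measure => //; rewrite inE//; [exact: measurableC|];
      apply: measurableU => //; exact: measurableU.
  have mbad12 : measurable (bad1 `|` bad2) by exact: measurableU.
  apply: (le_trans (@measureU2 _ _ _ P _ _ mbad12 mbad3)).
  rewrite EFinD leeD// (le_trans (@measureU2 _ _ _ P _ _ mbad1 mbad2))//.
  by rewrite EFinD leeD//; [exact: total_abs_tail|exact: small_coords_tail].
rewrite probability_setC// in Pbad.
rewrite leeBlDr//; rewrite leeBlDr// in Pbad.
  by rewrite addeC.
exact: fin_num_measure.
Qed.

End gaussian.
End random_projection.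

(** * Choice of the constants and passage to the limit *)

Theorem theorem6 (R : realType) :
  exists (d : nat -> nat) (A B : forall n : nat, 'I_n -> 'rV[R]_(d n)),
    (forall n : nat, injective (A n) /\ injective (B n)) /\
    forall m : nat -> nat,
      (forall n : nat, (0 < m n)%N) ->
      (fun n : nat => (m n)%:R : R) =o_\oo (fun n : nat => ln n%:R : R) ->
      forall (disp : nat -> measure_display)
             (T : forall n : nat, measurableType (disp n))
             (P : forall n : nat, probability (T n) R)
             (G : forall n : nat, 'I_(d n) * 'I_(m n) -> {RV (P n) >-> R}),
        (forall n : nat, gaussian_projection (G n)) ->
        forall C : R,
          P n [set w | pullback_cost_gt (A n) (B n) (random_mx (G n) w)
                         (C * min_matching_cost (A n) (B n))]
            @[n --> \oo] --> 1%E.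
Proof.
(* The dimension is [n + 1]: one axis per anchor and one for the unit direction. *)
exists S, (@pointA R), (@pointB R); split.
  by move=> n; split; [exact: pointA_inj|exact: pointB_inj].
move=> m m0 mo disp T P G gaussG C.
set target := fun n => [set w | pullback_cost_gt (@pointA R n) (@pointB R n)
  (random_mx (G n) w) (C * min_matching_cost (@pointA R n) (@pointB R n))].
have mtarget n : measurable (target n) by exact: measurable_pullback_cost_gt.
apply/fine_cvgP; split; first by near=> n; exact: fin_num_measure.
apply/cvgrPdist_le => eps eps0.
(* Chosen so that [h / 4] exceeds [|C|], the minimum cost being at most [n]. *)
pose h := (Num.truncn (4 * `|C|)).+1.
have h0' : 0 < h%:R :> R by rewrite ltr0n.
have Ch : `|C| < h%:R / 4.
  by rewrite ltr_pdivlMr// mulrC truncnS_gt.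
(* Both [8 kappa] and [2 / t] become [eps / 3]. *)
pose kappa := eps / 24; pose t := 6 / eps.
have k0 : 0 < kappa by rewrite divr_gt0.
have t0 : 0 < t by rewrite divr_gt0.
pose delta := kappa / (16 * h%:R).
have d0 : 0 < delta by rewrite divr_gt0// mulr_gt0.
pose a : R := ((2 * (16 * h)) ^ 2)%:R * t / delta.
(* [N] depends on [eps] and [C] but not on [n], so the number of cells is exponential in [m n] with
   a fixed base. *)
pose N := (Num.truncn (a * (16 * h%:R))).+1.
have aN : ((2 * (16 * h)) ^ 2)%:R * t / (delta * N%:R) <= (16 * h%:R)^-1.
  rewrite invfM mulrA -/a ler_pdivrMr ?ltr0n// mulrC ler_pdivlMr ?mulr_gt0//.
  by rewrite ltW// truncnS_gt.
(* With [m n <= e ln n] the exponent [3 (N + 2) m n] is at most [(ln n) / 2], so the cube of the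
   bound on the number of cells is at most [sqrt n]. *)
pose e : R := (6 * (N + 2)%:R)^-1.
have e0 : 0 < e by rewrite invr_gt0 mulr_gt0// ltr0n addn2.
have /eqoP/(_ e e0) mln := mo.
(* Once [sqrt n >= b], the term [512 h^2 / sqrt n] is at most [eps / 3]. *)
pose b : R := 3 * (512 * h%:R ^+ 2) / eps.
have b0 : 0 <= b.
  apply: divr_ge0; last exact: ltW.
  by apply: mulr_ge0; [exact: ler0n|apply: mulr_ge0; [exact: ler0n|exact: sqr_ge0]].
near=> n.
have n0 : (0 < n)%N by near: n; exact: nbhs_infty_gt.
have n0' : 0 < n%:R :> R by rewrite ltr0n.
have hn : (2 * h <= n)%N by near: n; exact: nbhs_infty_ge.
have nbig : b ^+ 2 <= n%:R.
  by near: n; exact: nbhs_infty_ger.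
have mn : (m n)%:R <= e * ln n%:R.
  have : `|(m n)%:R : R| <= e * `|ln n%:R| by near: n.
  by rewrite !ger0_norm// ln_ge0// ler1n.
have cn : C * min_matching_cost (@pointA R n) (@pointB R n) < h%:R / 4 * n%:R.
  apply: (@le_lt_trans _ _ (`|C| * n%:R)); last by rewrite ltr_pM2r.
  apply: (@le_trans _ _ (`|C| * min_matching_cost (@pointA R n) (@pointB R n))).
    by rewrite ler_wpM2r ?ler_norm// min_matching_cost_ge0.
  by rewrite ler_wpM2l// min_matching_cost_points.
have := @pullback_probability _ _ _ _ _ _ _ (m0 n) (gaussG n) h N kappa t _
  isT isT k0 t0 hn cn aN.
rewrite -/(target n).
set K : R := _ ^+ m n.
(* This is [sqrt n], written as an exponential to be compared with powers of 2. *)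
pose s : R := expR (ln n%:R / 2).
have s0 : 0 < s by exact: expR_gt0.
have ss : s * s = n%:R by rewrite -expRD -splitr lnK ?posrE.
have Ks : K ^+ 3 <= s.
  have -> : K ^+ 3 = 2 ^+ ((N + 2) * m n * 3) by rewrite /K -!exprM mulnA.
  apply: (@le_trans _ _ (expR 1 ^+ ((N + 2) * m n * 3))).
    by rewrite lerXn2r ?nnegrE ?expR_ge0//; have := expR_ge1Dx (1 : R); lra.
  rewrite -expRM_natl ler_expR mulr1 !natrM.
  have N2 : 0 < (N + 2)%:R :> R by rewrite ltr0n addn2.
  have -> : ln n%:R / 2 = (N + 2)%:R * (e * ln n%:R) * 3.
    by rewrite /e; field; rewrite gt_eqF.
  by rewrite ler_pM2r// ler_pM2l.
have bs : b <= s.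
  by rewrite -ler_sqr ?nnegrE ?b0 ?(ltW s0)// [leRHS]expr2 ss.
have last_term : 512 * h%:R ^+ 2 * K ^+ 3 / n%:R <= eps / 3.
  rewrite ler_pdivrMr// -ss.
  have {bs} := bs; rewrite /b ler_pdivrMr//.
  have : 0 <= 512 * h%:R ^+ 2 :> R by rewrite mulr_ge0 ?sqr_ge0 ?ler0n.
  set c := 512 * _ => c0 cs.
  apply: (@le_trans _ _ (c * s)); first by rewrite ler_wpM2l.
  by rewrite mulrA ler_pM2r//; lra.
have -> : 2 / t = eps / 3 by rewrite /t; field; rewrite gt_eqF.
move=> Pge.
have Pfin : P n (target n) \is a fin_num by exact: fin_num_measure.
have Ple : (P n (target n) <= 1)%E by exact: probability_le1.
move: Pge Ple; rewrite -(fineK Pfin) -EFinB !lee_fin => Pge Ple /=.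
by rewrite ger0_norm ?subr_ge0//; move: Pge; rewrite /kappa; lra.
Unshelve. all: by end_near. Qed.
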